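(* Let $(\lambda_n)_{n\in\mathbb{N}_0}$ be complex numbers with $\limsup_{n\to\infty}|\lambda_n|/n\le\beta$ for some $\beta\ge0$. Let $\gamma>0$ and $f\in C^\infty[x_0,x_0+\gamma]$ (complex-valued), and assume there are constants $\sigma\ge0$, $C>0$ with $|D^{(2n)}f(t)|\le C(2n)!\sigma^{2n}$ for all $t\in[x_0,x_0+\gamma]$ and $n\in\mathbb{N}_0$. Then there is $\delta\in(0,\gamma)$ such that $$s_{2n-1}(x)=\sum_{k=0}^{2n-1}D^{(k)}f(x_0)\,\Phi_{\Lambda_k}(x-x_0)$$ converges to $f(x)$ uniformly on $[x_0,x_0+\delta]$ as $n\to\infty$.
   Context: For $\lambda_0,\dots,\lambda_n\in\mathbb{C}$ the fundamental function is the entire function $\Phi_{(\lambda_0,\dots,\lambda_n)}(z)=\frac{1}{2\pi i}\int_{|w|=R}\frac{e^{zw}}{(w-\lambda_0)\cdots(w-\lambda_n)}\,dw$, where $R>\max_j|\lambda_j|$ and the circle is positively oriented. For a sequence $(\lambda_n)$, $\Lambda_n=(\lambda_0,\dots,\lambda_n)$, $\Phi_{\Lambda_n}=\Phi_{(\lambda_0,\dots,\lambda_n)}$, and $D^{(n)}f=(\frac{d}{dt}-\lambda_0)\cdots(\frac{d}{dt}-\lambda_{n-1})f$ with $D^{(0)}f=f$ (one-sided derivatives at endpoints). *)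

(* Defs.v *)
From Stdlib Require Import Reals Lra ClassicalEpsilon.
Open Scope R_scope.

Definition Cplx := (R * R)%type.
Definition RtoC (a : R) : Cplx := (a, 0).
Definition Cadd (z w : Cplx) : Cplx := (fst z + fst w, snd z + snd w).
Definition Copp (z : Cplx) : Cplx := (- fst z, - snd z).
Definition Csub (z w : Cplx) : Cplx := Cadd z (Copp w).
Definition Cmul (z w : Cplx) : Cplx :=
  (fst z * fst w - snd z * snd w, fst z * snd w + snd z * fst w).
Definition Cinv (z : Cplx) : Cplx :=
  let d := fst z * fst z + snd z * snd z in (fst z / d, - snd z / d).
Definition Cdiv (z w : Cplx) : Cplx := Cmul z (Cinv w).
Definition Cexp (z : Cplx) : Cplx := (exp (fst z) * cos (snd z), exp (fst z) * sin (snd z)).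
Definition Cnorm (z : Cplx) : R := sqrt (fst z * fst z + snd z * snd z).

(** Real Riemann integral as a total function (value of RiemannInt when the
    function is Riemann integrable, 0 otherwise; RiemannInt does not depend on
    the integrability proof). *)
Definition RInt (g : R -> R) (a b : R) : R :=
  match excluded_middle_informative (inhabited (Riemann_integrable g a b)) with
  | left H => RiemannInt (epsilon H (fun _ => True))
  | right _ => 0
  end.

Definition CInt (g : R -> Cplx) (a b : R) : Cplx :=
  (RInt (fun t => fst (g t)) a b, RInt (fun t => snd (g t)) a b).

Fixpoint Cprod_lam (lam : nat -> Cplx) (w : Cplx) (n : nat) : Cplx :=
  match n with
  | O => Csub w (lam O)
  | S m => Cmul (Cprod_lam lam w m) (Csub w (lam (S m)))
  end.

Fixpoint sum_norm (lam : nat -> Cplx) (n : nat) : R :=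
  match n with
  | O => Cnorm (lam O)
  | S m => sum_norm lam m + Cnorm (lam (S m))
  end.

(** Fundamental function Phi_{(lam 0,...,lam n)}(z)
      = 1/(2 pi i) \oint_{|w|=R} e^{zw} / ((w-lam 0)...(w-lam n)) dw,
    with the radius R := 1 + sum_j |lam j| > max_j |lam j|, circle positively
    oriented, parametrised w = R e^{i theta}, dw = i w dtheta, theta in [0, 2pi]. *)
Definition Phi (lam : nat -> Cplx) (n : nat) (z : Cplx) : Cplx :=
  let Rad := 1 + sum_norm lam n in
  let w := fun th : R => (Rad * cos th, Rad * sin th) in
  let g := fun th : R =>
    Cmul (Cdiv (Cexp (Cmul z (w th))) (Cprod_lam lam (w th) n)) (Cmul (0, 1) (w th)) in
  (* 1/(2 pi i) = - i / (2 pi) *)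
  Cmul (0, - / (2 * PI)) (CInt g 0 (2 * PI)).

Definition has_deriv_on (g g' : R -> R) (a b : R) : Prop :=
  forall t, a <= t <= b ->
  forall eps, 0 < eps -> exists d, 0 < d /\
    forall h, h <> 0 -> Rabs h < d -> a <= t + h <= b ->
      Rabs ((g (t + h) - g t) / h - g' t) < eps.

Definition Chas_deriv_on (g g' : R -> Cplx) (a b : R) : Prop :=
  has_deriv_on (fun t => fst (g t)) (fun t => fst (g' t)) a b /\
  has_deriv_on (fun t => snd (g t)) (fun t => snd (g' t)) a b.

Fixpoint Csum (F : nat -> Cplx) (n : nat) : Cplx :=
  match n with
  | O => (0, 0)
  | S m => Cadd (Csum F m) (F m)
  end.

(* Main.v *)
(** Integrating [d/dt (D^(k) f (t) Phi_k (x - t)) = D^(k+1) f (t) Phi_k (x - t) - D^(k) f (t) Phi_(k-1) (x - t)]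
    gives a Taylor formula: [sum_(k<2n) D^(k) f (t) Phi_k (x - t)] goes from [s_(2n-1) (x)] at [t = x0]
    to [f x] at [t = x], with derivative [D^(2n) f (t) Phi_(2n-1) (x - t)].
    As [Phi_n' = lam_n Phi_n + Phi_(n-1)] and [Phi_n 0 = [n = 0]], induction gives
    [|Phi_n u| <= exp (M u) u^n / n!] with [M = max_(j<=n) |lam_j| = O(n)], so for [x - x0 <= delta]
    the remainder is [O(n q^(2n))], where [q = sigma delta exp ((beta + 1) delta)] is small with [delta].
    The contour radius in [Phi] depends on [n]; the independence of the radius follows from
    uniqueness for the same differential equations, the initial values being computed for
    each radius separately. *)

From Stdlib Require Import Reals Arith Lra Lia FunctionalExtensionality.
From Coquelicot Require Import Coquelicot.
Require Import Defs.
Open Scope R_scope.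

(** * Calculus for complex-valued functions of a real variable *)

Lemma Cnorm_Cmod (z : C) : Cnorm z = Cmod z.
Proof. unfold Cnorm, Cmod. f_equal. ring. Qed.

Lemma Cinv_Coquelicot (z : C) : Defs.Cinv z = Complex.Cinv z.
Proof.
  unfold Defs.Cinv, Complex.Cinv.
  replace (fst z ^ 2 + snd z ^ 2) with (fst z * fst z + snd z * snd z) by ring.
  reflexivity.
Qed.

Lemma Cmod_le_add_abs (z : C) : Cmod z <= Rabs (fst z) + Rabs (snd z).
Proof.
  assert (E : z = Cplus (Complex.RtoC (fst z)) (Cmult Ci (Complex.RtoC (snd z))))
    by (apply injective_projections; simpl; ring).
  rewrite E at 1. eapply Rle_trans; [apply Cmod_triangle|].
  rewrite Cmod_mult, Cmod_Ci, !Cmod_R. lra.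
Qed.

Lemma Cexp_0 : Cexp (Complex.RtoC 0) = Complex.RtoC 1.
Proof. apply injective_projections; simpl; rewrite exp_0, ?cos_0, ?sin_0; ring. Qed.

Lemma Cmod_Cexp (z : C) : Cmod (Cexp z) = exp (fst z).
Proof.
  unfold Cmod, Cexp; simpl.
  replace (_ + _) with (Rsqr (exp (fst z))).
  - apply sqrt_Rsqr, Rlt_le, exp_pos.
  - generalize (sin2_cos2 (snd z)); unfold Rsqr; intros H.
    transitivity (exp (fst z) * exp (fst z) * (sin (snd z) * sin (snd z) + cos (snd z) * cos (snd z))).
    + rewrite H; ring.
    + ring.
Qed.

(** Componentwise, to match [Chas_deriv_on] and to reduce every rule to real calculus. *)
Definition Cderive (g : R -> C) (t : R) (l : C) : Prop :=
  is_derive (fun s => fst (g s)) t (fst l) /\ is_derive (fun s => snd (g s)) t (snd l).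

Definition Ccontinuous (g : R -> C) : Prop :=
  forall t, continuous (fun s => fst (g s)) t /\ continuous (fun s => snd (g s)) t.

Lemma Cderive_value (g : R -> C) (t : R) (l l' : C) :
  Cderive g t l -> l = l' -> Cderive g t l'.
Proof. intros H <-; exact H. Qed.

Lemma Cderive_const (c : C) (t : R) : Cderive (fun _ => c) t (Complex.RtoC 0).
Proof. split; apply (is_derive_const (V := R_NormedModule)). Qed.

Lemma Cderive_plus (g h : R -> C) (t : R) (a b : C) :
  Cderive g t a -> Cderive h t b -> Cderive (fun s => (g s + h s)%C) t (a + b)%C.
Proof.
  intros [H1 H2] [H3 H4]; split; simpl; apply (is_derive_plus (V := R_NormedModule)); assumption.
Qed.

Lemma is_derive_Rmult (f g : R -> R) (t a b : R) :
  is_derive f t a -> is_derive g t b -> is_derive (fun s => f s * g s) t (a * g t + f t * b).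
Proof. intros Hf Hg. apply (is_derive_mult (K := R_AbsRing) f g); auto. intros; apply Rmult_comm. Qed.

Lemma Cderive_mult (g h : R -> C) (t : R) (a b : C) :
  Cderive g t a -> Cderive h t b ->
  Cderive (fun s => (g s * h s)%C) t (a * h t + g t * b)%C.
Proof.
  intros [H1 H2] [H3 H4]; split; simpl.
  - replace (_ + _) with ((fst a * fst (h t) + fst (g t) * fst b) -
      (snd a * snd (h t) + snd (g t) * snd b)) by ring.
    apply (is_derive_minus (V := R_NormedModule)); apply is_derive_Rmult; assumption.
  - replace (_ + _) with ((fst a * snd (h t) + fst (g t) * snd b) +
      (snd a * fst (h t) + snd (g t) * fst b)) by ring.
    apply (is_derive_plus (V := R_NormedModule)); apply is_derive_Rmult; assumption.
Qed.

Lemma Cderive_scal (c : C) (g : R -> C) (t : R) (a : C) :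
  Cderive g t a -> Cderive (fun s => (c * g s)%C) t (c * a)%C.
Proof.
  intros H. eapply Cderive_value.
  - apply (Cderive_mult (fun _ => c) g); [apply Cderive_const | exact H].
  - ring.
Qed.

Lemma Cderive_comp_sub (g : R -> C) (x t : R) (a : C) :
  Cderive g (x - t) a -> Cderive (fun s => g (x - s)) t (- a)%C.
Proof.
  assert (Hs : is_derive (fun s : R => x - s) t (-1)) by (auto_derive; [exact I | ring]).
  intros [H1 H2]; split; simpl.
  - replace (- fst a) with (scal (-1) (fst a)) by (unfold scal; simpl; unfold mult; simpl; ring).
    apply (is_derive_comp (fun s => fst (g s)) (fun s => x - s)); assumption.
  - replace (- snd a) with (scal (-1) (snd a)) by (unfold scal; simpl; unfold mult; simpl; ring).
    apply (is_derive_comp (fun s => snd (g s)) (fun s => x - s)); assumption.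
Qed.

Lemma Cderive_Cexp (g : R -> C) (t : R) (a : C) :
  Cderive g t a -> Cderive (fun s => Cexp (g s)) t (a * Cexp (g t))%C.
Proof.
  intros [H1 H2].
  assert (E := is_derive_comp exp (fun s => fst (g s)) t _ _ (is_derive_exp _) H1).
  assert (Ec := is_derive_comp cos (fun s => snd (g s)) t _ _ (is_derive_cos _) H2).
  assert (Es := is_derive_comp sin (fun s => snd (g s)) t _ _ (is_derive_sin _) H2).
  split; simpl.
  - evar_last; [apply (is_derive_Rmult _ _ _ _ _ E Ec)|].
    unfold scal; simpl; unfold mult; simpl; ring.
  - evar_last; [apply (is_derive_Rmult _ _ _ _ _ E Es)|].
    unfold scal; simpl; unfold mult; simpl; ring.
Qed.

Lemma Cderive_RtoC (t : R) : Cderive Complex.RtoC t (Complex.RtoC 1).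
Proof. split; simpl; auto_derive; auto. Qed.

Lemma Cderive_Cexp_lin (l : C) (t : R) :
  Cderive (fun s => Cexp (Complex.RtoC s * l)%C) t (l * Cexp (Complex.RtoC t * l))%C.
Proof.
  apply Cderive_Cexp. eapply Cderive_value.
  - apply (Cderive_mult _ (fun _ => l)); [apply Cderive_RtoC | apply Cderive_const].
  - ring.
Qed.

Lemma is_derive_continuous (f : R -> R) (t l : R) : is_derive f t l -> continuous f t.
Proof. intros H. apply (@ex_derive_continuous R_AbsRing R_NormedModule). exists l; exact H. Qed.

Lemma Ccontinuous_Cderive (g g' : R -> C) :
  (forall t, Cderive g t (g' t)) -> Ccontinuous g.
Proof. intros H t; destruct (H t); split; eapply is_derive_continuous; eassumption. Qed.

Lemma Ccontinuous_const (c : C) : Ccontinuous (fun _ => c).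
Proof. intros t; split; apply continuous_const. Qed.

Lemma Ccontinuous_plus (g h : R -> C) :
  Ccontinuous g -> Ccontinuous h -> Ccontinuous (fun s => (g s + h s)%C).
Proof.
  intros Hg Hh t; destruct (Hg t), (Hh t); split; simpl;
    apply (continuous_plus (V := R_NormedModule)); assumption.
Qed.

Lemma Ccontinuous_mult (g h : R -> C) :
  Ccontinuous g -> Ccontinuous h -> Ccontinuous (fun s => (g s * h s)%C).
Proof.
  intros Hg Hh t; destruct (Hg t), (Hh t); split; simpl.
  - apply (continuous_minus (V := R_NormedModule)); apply (continuous_mult (K := R_AbsRing)); assumption.
  - apply (continuous_plus (V := R_NormedModule)); apply (continuous_mult (K := R_AbsRing)); assumption.
Qed.

Lemma Ccontinuous_inv (g : R -> C) :
  Ccontinuous g -> (forall t, g t <> Complex.RtoC 0) -> Ccontinuous (fun s => (/ g s)%C).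
Proof.
  intros Hg Hn t; destruct (Hg t) as [H1 H2].
  assert (Hd : fst (g t) ^ 2 + snd (g t) ^ 2 <> 0).
  { intros E; apply (Hn t), injective_projections; simpl; nra. }
  assert (Hi : continuous (fun s => / (fst (g s) ^ 2 + snd (g s) ^ 2)) t).
  { apply continuous_Rinv_comp; [|exact Hd].
    apply (continuous_plus (V := R_NormedModule));
      (apply (continuous_mult (K := R_AbsRing)); [assumption|]);
      (apply (continuous_mult (K := R_AbsRing)); [assumption|]); apply continuous_const. }
  split; simpl; unfold Rdiv; apply (continuous_mult (K := R_AbsRing)); try exact Hi.
  - exact H1.
  - apply (continuous_opp (V := R_NormedModule)); exact H2.
Qed.

Lemma Ccontinuous_pow (g : R -> C) (k : nat) : Ccontinuous g -> Ccontinuous (fun s => (g s ^ k)%C).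
Proof.
  intros Hg; induction k; simpl; [apply Ccontinuous_const | apply Ccontinuous_mult; assumption].
Qed.

Lemma Ccontinuous_Cexp (g : R -> C) : Ccontinuous g -> Ccontinuous (fun s => Cexp (g s)).
Proof.
  intros Hg t; destruct (Hg t) as [H1 H2]; split; simpl;
    apply (continuous_mult (K := R_AbsRing)).
  1,3: apply (continuous_comp (fun s => fst (g s)) exp); [exact H1|].
  1,2: eapply is_derive_continuous, is_derive_exp.
  - apply (continuous_comp (fun s => snd (g s)) cos); [exact H2|].
    eapply is_derive_continuous, is_derive_cos.
  - apply (continuous_comp (fun s => snd (g s)) sin); [exact H2|].
    eapply is_derive_continuous, is_derive_sin.
Qed.

Lemma is_derive_nonneg_le (k k' : R -> R) (a b : R) :
  a <= b -> (forall t, a <= t <= b -> is_derive k t (k' t)) ->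
  (forall t, a <= t <= b -> 0 <= k' t) -> k a <= k b.
Proof.
  intros Hab Hd Hp.
  destruct (MVT_gen k a b k') as [c [Hc E]].
  - rewrite Rmin_left, Rmax_right by assumption. intros t Ht; apply Hd; lra.
  - rewrite Rmin_left, Rmax_right by assumption. intros t Ht.
    apply continuity_pt_filterlim. eapply is_derive_continuous, Hd, Ht.
  - rewrite Rmin_left, Rmax_right in Hc by assumption.
    assert (0 <= b - a) by lra.
    generalize (Rmult_le_pos _ _ (Hp c Hc) H); lra.
Qed.

(* Applied to the real part of [conj (g b - g a) * g], so that no constant is lost. *)
Lemma Cderive_mean_value_le (g g' : R -> C) (H H' : R -> R) (a b : R) :
  a <= b ->
  (forall t, a <= t <= b -> Cderive g t (g' t)) ->
  (forall t, a <= t <= b -> is_derive H t (H' t)) ->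
  (forall t, a <= t <= b -> Cmod (g' t) <= H' t) ->
  Cmod (g b - g a)%C <= H b - H a.
Proof.
  intros Hab Hg HH Hle.
  set (z := (g b - g a)%C).
  assert (K : Cmod z * H a - Re (Cconj z * g a)%C <= Cmod z * H b - Re (Cconj z * g b)%C).
  { apply (is_derive_nonneg_le (fun t => Cmod z * H t - Re (Cconj z * g t)%C)
      (fun t => Cmod z * H' t - Re (Cconj z * g' t)%C)); [exact Hab| |].
    - intros t Ht. apply (is_derive_minus (V := R_NormedModule)).
      + apply is_derive_scal; auto.
      + destruct (Cderive_scal (Cconj z) g t (g' t) (Hg t Ht)) as [D1 _]. exact D1.
    - intros t Ht.
      generalize (re_le_Cmod (Cconj z * g' t)%C). rewrite Cmod_mult, Cmod_conj.
      intros A. generalize (Rle_abs (Re (Cconj z * g' t)%C)).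
      generalize (Rmult_le_compat_l _ _ _ (Cmod_ge_0 z) (Hle t Ht)). lra. }
  assert (E : Re (Cconj z * g b)%C - Re (Cconj z * g a)%C = Cmod z ^ 2).
  { rewrite Cmod2_alt. unfold z; simpl. unfold Re, Im; simpl. ring. }
  destruct (Rle_lt_or_eq_dec _ _ (Cmod_ge_0 z)) as [P|P].
  - apply Rmult_le_reg_l with (Cmod z); [exact P|]. nra.
  (* When [z = 0] no factor [Cmod z] can be cancelled; the claim is then [H a <= H b], which holds
     because [0 <= Cmod (g' t) <= H' t]. *)
  - rewrite <- P. apply -> Rminus_le_0.
    apply (is_derive_nonneg_le H H'); auto.
    intros t Ht. eapply Rle_trans; [apply Cmod_ge_0 | auto].
Qed.

(** * Integrals over a circle *)

Definition Cint (g : R -> C) : C :=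
  (RInt.RInt (fun t => fst (g t)) 0 (2 * PI), RInt.RInt (fun t => snd (g t)) 0 (2 * PI)).

Lemma Ccontinuous_ex_RInt (g : R -> C) (a b : R) :
  Ccontinuous g ->
  ex_RInt (V := R_NormedModule) (fun t => fst (g t)) a b /\
  ex_RInt (V := R_NormedModule) (fun t => snd (g t)) a b.
Proof.
  intros Hg; split; apply (ex_RInt_continuous (V := R_CompleteNormedModule)); intros t _; apply Hg.
Qed.

(** Integrability excludes the default value 0, and the Riemann integral is the same for whichever
    integrability proof [epsilon] selects. *)
Lemma Defs_RInt_Coquelicot (g : R -> R) (a b : R) :
  ex_RInt g a b -> Defs.RInt g a b = RInt.RInt g a b.
Proof.
  intros Hg. unfold Defs.RInt.
  destruct (ClassicalEpsilon.excluded_middle_informative _) as [H|H].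
  - symmetry; apply RInt_Reals.
  - exfalso; apply H. constructor. apply ex_RInt_Reals_0, Hg.
Qed.

Lemma CInt_Cint (g : R -> C) : Ccontinuous g -> CInt g 0 (2 * PI) = Cint g.
Proof.
  intros Hg. destruct (Ccontinuous_ex_RInt g 0 (2 * PI) Hg).
  unfold CInt, Cint. rewrite !Defs_RInt_Coquelicot by assumption. reflexivity.
Qed.

Lemma Cint_ext (g h : R -> C) : (forall t, g t = h t) -> Cint g = Cint h.
Proof.
  intros E; unfold Cint; f_equal;
    apply (RInt_ext (V := R_CompleteNormedModule)); intros t _; rewrite E; reflexivity.
Qed.

Lemma Cint_plus (g h : R -> C) :
  Ccontinuous g -> Ccontinuous h -> Cint (fun t => (g t + h t)%C) = (Cint g + Cint h)%C.
Proof.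
  intros Hg Hh.
  destruct (Ccontinuous_ex_RInt g 0 (2 * PI) Hg), (Ccontinuous_ex_RInt h 0 (2 * PI) Hh).
  apply injective_projections; simpl; apply (RInt_plus (V := R_CompleteNormedModule)); assumption.
Qed.

Lemma Cint_scal (c : C) (g : R -> C) :
  Ccontinuous g -> Cint (fun t => (c * g t)%C) = (c * Cint g)%C.
Proof.
  intros Hg.
  destruct (Ccontinuous_ex_RInt g 0 (2 * PI) Hg) as [H1 H2].
  assert (S : forall (f : R -> R) l, ex_RInt f 0 (2 * PI) -> ex_RInt (fun t => l * f t) 0 (2 * PI))
    by (intros; apply (ex_RInt_scal (V := R_NormedModule)); assumption).
  assert (S' : forall (f : R -> R) l, ex_RInt f 0 (2 * PI) ->
    RInt.RInt (fun t => l * f t) 0 (2 * PI) = l * RInt.RInt f 0 (2 * PI))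
    by (intros; apply (RInt_scal (V := R_CompleteNormedModule)); assumption).
  apply injective_projections; simpl; rewrite <- !S' by assumption.
  - apply (RInt_minus (V := R_CompleteNormedModule)); apply S; assumption.
  - apply (RInt_plus (V := R_CompleteNormedModule)); apply S; assumption.
Qed.

(** The form in which Cauchy's theorem enters: a primitive along a closed curve takes the same value
    at both ends. *)
Lemma Cint_Cderive_periodic (g g' : R -> C) :
  (forall t, Cderive g t (g' t)) -> Ccontinuous g' -> g (2 * PI) = g 0 ->
  Cint g' = Complex.RtoC 0.
Proof.
  intros Hd Hc E. apply injective_projections; simpl; apply (is_RInt_unique (V := R_CompleteNormedModule)).
  - replace 0 with (minus (fst (g (2 * PI))) (fst (g 0))) at 2
      by (rewrite E; apply (minus_eq_zero (G := R_AbelianGroup))).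
    apply (is_RInt_derive (V := R_CompleteNormedModule) (fun t => fst (g t)));
      intros t _; [apply Hd | apply Hc].
  - replace 0 with (minus (snd (g (2 * PI))) (snd (g 0))) at 2
      by (rewrite E; apply (minus_eq_zero (G := R_AbelianGroup))).
    apply (is_RInt_derive (V := R_CompleteNormedModule) (fun t => snd (g t)));
      intros t _; [apply Hd | apply Hc].
Qed.

(** The constant is [4 * PI] and not [2 * PI] because the two components are estimated separately;
    only its finiteness matters later. *)
Lemma Cmod_Cint_le (g : R -> C) (M : R) :
  Ccontinuous g -> (forall t, Cmod (g t) <= M) -> Cmod (Cint g) <= 4 * PI * M.
Proof.
  intros Hg HM. destruct (Ccontinuous_ex_RInt g 0 (2 * PI) Hg) as [H1 H2].
  generalize PI_RGT_0; intros HPI.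
  eapply Rle_trans; [apply Cmod_le_add_abs|].
  replace (4 * PI * M) with ((2 * PI - 0) * M + (2 * PI - 0) * M) by ring.
  unfold Cint; simpl.
  apply Rplus_le_compat; apply abs_RInt_le_const; try assumption; try lra;
    intros t _; (eapply Rle_trans; [|apply (HM t)]);
    (eapply Rle_trans; [|apply Rmax_Cmod]); [apply Rmax_l | apply Rmax_r].
Qed.

(** Differentiation under the integral sign for the real part of [exp (s (X + i Y)) (p + i q)]; the
    derivative replaces [p + i q] by [(X + i Y) (p + i q)]. *)
Lemma is_derive_RInt_exp_trig (X Y p q : R -> R) (u a b : R) :
  (forall t, continuous X t) -> (forall t, continuous Y t) ->
  (forall t, continuous p t) -> (forall t, continuous q t) ->
  is_derive (fun s => RInt.RInt (fun t =>
      exp (s * X t) * (cos (s * Y t) * p t - sin (s * Y t) * q t)) a b) u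
    (RInt.RInt (fun t =>
      exp (u * X t) * (cos (u * Y t) * (X t * p t - Y t * q t)
        - sin (u * Y t) * (X t * q t + Y t * p t))) a b).
Proof.
  intros HX HY Hp Hq.
  assert (Hd : forall v t, is_derive (fun s =>
      exp (s * X t) * (cos (s * Y t) * p t - sin (s * Y t) * q t)) v
      (exp (v * X t) * (cos (v * Y t) * (X t * p t - Y t * q t)
        - sin (v * Y t) * (X t * q t + Y t * p t)))).
  { intros v t. auto_derive; [exact I | ring]. }
  assert (C1 : forall (f : R -> R), (forall t, continuous f t) -> forall v t,
      continuity_2d_pt (fun _ y => f y) v t).
  { intros f Hf v t. apply (continuity_1d_2d_pt_comp f (fun _ y => y)).
    - apply continuity_pt_filterlim, Hf.
    - apply continuity_2d_pt_id2. }
  assert (C2 : forall (h f : R -> R), (forall t, continuous h t) -> (forall t, continuous f t) ->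
      forall v t, continuity_2d_pt (fun x y => h (x * f y)) v t).
  { intros h f Hh Hf v t. apply (continuity_1d_2d_pt_comp h (fun x y => x * f y)).
    - apply continuity_pt_filterlim, Hh.
    - apply continuity_2d_pt_mult; [apply continuity_2d_pt_id1 | apply C1, Hf]. }
  assert (Cexp' : forall t, continuous exp t) by (intros; eapply is_derive_continuous, is_derive_exp).
  assert (Ccos : forall t, continuous cos t) by (intros; eapply is_derive_continuous, is_derive_cos).
  assert (Csin : forall t, continuous sin t) by (intros; eapply is_derive_continuous, is_derive_sin).
  assert (Cd : forall v t, continuity_2d_pt (fun v t => exp (v * X t) *
      (cos (v * Y t) * (X t * p t - Y t * q t) - sin (v * Y t) * (X t * q t + Y t * p t))) v t).
  { intros v t. apply continuity_2d_pt_mult; [apply C2; assumption|].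
    apply continuity_2d_pt_minus; apply continuity_2d_pt_mult; try (apply C2; assumption).
    - apply continuity_2d_pt_minus; apply continuity_2d_pt_mult; apply C1; assumption.
    - apply continuity_2d_pt_plus; apply continuity_2d_pt_mult; apply C1; assumption. }
  assert (Cf : forall v t, continuous (fun t =>
      exp (v * X t) * (cos (v * Y t) * p t - sin (v * Y t) * q t)) t).
  { intros v t.
    assert (Cc : forall (h f : R -> R), (forall t, continuous h t) -> (forall t, continuous f t) ->
      continuous (fun y => h (v * f y)) t).
    { intros h f Hh Hf. apply (continuous_comp (fun y => v * f y) h); [|apply Hh].
      apply (continuous_mult (K := R_AbsRing)); [apply continuous_const | apply Hf]. }
    apply (continuous_mult (K := R_AbsRing)); [apply Cc; assumption|].
    apply (continuous_minus (V := R_NormedModule)); apply (continuous_mult (K := R_AbsRing));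
      auto. }
  (* [is_derive_RInt_param] has [Derive] under the integral, so the explicit integrand is first
     brought to that form. *)
  erewrite RInt_ext.
  - apply is_derive_RInt_param.
    + apply filter_forall. intros v t _. eexists; apply Hd.
    + intros t _. eapply continuity_2d_pt_ext; [|apply Cd].
      intros v y. symmetry. apply is_derive_unique, Hd.
    + apply filter_forall. intros v.
      apply (ex_RInt_continuous (V := R_CompleteNormedModule)). intros t _. apply Cf.
  - intros t _. symmetry. apply is_derive_unique, Hd.
Qed.

Lemma Cderive_Cint_Cexp (w c : R -> C) (u : R) :
  Ccontinuous w -> Ccontinuous c ->
  Cderive (fun s => Cint (fun t => (Cexp (Complex.RtoC s * w t) * c t)%C)) u
    (Cint (fun t => (Cexp (Complex.RtoC u * w t) * (w t * c t))%C)).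
Proof.
  intros Hw Hc.
  split; unfold Cint; cbn [fst snd].
  - eapply is_derive_ext; [|evar_last].
    2: apply (is_derive_RInt_exp_trig (fun t => fst (w t)) (fun t => snd (w t))
        (fun t => fst (c t)) (fun t => snd (c t))); intros; apply Hw || apply Hc.
    + intros s. apply (RInt_ext (V := R_CompleteNormedModule)). intros t _. simpl.
      replace (s * fst (w t) - 0 * snd (w t)) with (s * fst (w t)) by ring.
      replace (s * snd (w t) + 0 * fst (w t)) with (s * snd (w t)) by ring. ring.
    + apply (RInt_ext (V := R_CompleteNormedModule)). intros t _. simpl.
      replace (u * fst (w t) - 0 * snd (w t)) with (u * fst (w t)) by ring.
      replace (u * snd (w t) + 0 * fst (w t)) with (u * snd (w t)) by ring. ring.
  (* The imaginary part of a number is the real part of [- i] times it, so [c] is replaced by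
     [- i c], with components [snd c] and [- fst c]. *)
  - eapply is_derive_ext; [|evar_last].
    2: apply (is_derive_RInt_exp_trig (fun t => fst (w t)) (fun t => snd (w t))
        (fun t => snd (c t)) (fun t => - fst (c t))); intros;
        try (apply Hw || apply Hc); apply (continuous_opp (V := R_NormedModule)); apply Hc.
    + intros s. apply (RInt_ext (V := R_CompleteNormedModule)). intros t _. simpl.
      replace (s * fst (w t) - 0 * snd (w t)) with (s * fst (w t)) by ring.
      replace (s * snd (w t) + 0 * fst (w t)) with (s * snd (w t)) by ring. ring.
    + apply (RInt_ext (V := R_CompleteNormedModule)). intros t _. simpl.
      replace (u * fst (w t) - 0 * snd (w t)) with (u * fst (w t)) by ring.
      replace (u * snd (w t) + 0 * fst (w t)) with (u * snd (w t)) by ring. ring.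
Qed.

(** * The contour integral with an arbitrary radius *)

(** Here [n] counts factors, so that the inductions can start from the empty product; [Cprod_lam]
    starts with one factor. *)
Fixpoint linear_factors_prod (lam : nat -> C) (n : nat) (w : C) : C :=
  match n with
  | O => Complex.RtoC 1
  | S m => (linear_factors_prod lam m w * (w - lam m))%C
  end.

Lemma Cprod_lam_linear_factors (lam : nat -> C) (n : nat) (w : C) :
  Cprod_lam lam w n = linear_factors_prod lam (S n) w.
Proof.
  induction n as [|n IH].
  - symmetry; apply Cmult_1_l.
  - change (Cprod_lam lam w (S n)) with (Cmult (Cprod_lam lam w n) (w - lam (S n))%C).
    rewrite IH. reflexivity.
Qed.

Definition circle (r th : R) : C := (r * cos th, r * sin th).

Lemma Cmod_circle (r th : R) : 0 < r -> Cmod (circle r th) = r.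
Proof.
  intros Hr. unfold Cmod, circle; simpl.
  replace (_ + _) with (Rsqr r).
  - apply sqrt_Rsqr; lra.
  - generalize (sin2_cos2 th); unfold Rsqr; intros H.
    transitivity (r * r * (sin th * sin th + cos th * cos th)); [rewrite H|]; ring.
Qed.

Lemma circle_neq_0 (r th : R) : 0 < r -> circle r th <> Complex.RtoC 0.
Proof. intros Hr. apply Cmod_gt_0. rewrite Cmod_circle; assumption. Qed.

Lemma circle_periodic (r : R) : circle r (2 * PI) = circle r 0.
Proof. unfold circle. rewrite cos_2PI, sin_2PI, cos_0, sin_0. reflexivity. Qed.

Lemma Cderive_circle (r t : R) : Cderive (circle r) t (Ci * circle r t)%C.
Proof. split; simpl; auto_derive; auto; ring. Qed.

Lemma Ccontinuous_circle (r : R) : Ccontinuous (circle r).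
Proof. exact (Ccontinuous_Cderive _ _ (Cderive_circle r)). Qed.

Lemma Cinv_circle (r th : R) :
  0 < r -> (/ circle r th)%C = (cos th / r, - sin th / r).
Proof.
  intros Hr. generalize (sin2_cos2 th); unfold Rsqr; intros H.
  assert (E : (r * cos th) ^ 2 + (r * sin th) ^ 2 = r * r).
  { transitivity (r * r * (sin th * sin th + cos th * cos th)); [|rewrite H]; ring. }
  unfold Complex.Cinv, circle; cbn [fst snd]. rewrite E.
  apply injective_projections; cbn [fst snd]; field; lra.
Qed.

(** With [dw = i w dth], this provides a primitive of [w^-(k+1) dw] for [k >= 1]. *)
Lemma Cderive_Cinv_circle_pow (r t : R) (k : nat) :
  0 < r ->
  Cderive (fun th => (/ circle r th) ^ k)%C t
    (Complex.RtoC (- INR k) * (Ci * (/ circle r t) ^ k))%C.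
Proof.
  intros Hr.
  assert (H1 : Cderive (fun th => (/ circle r th)%C) t (- Ci * / circle r t)%C).
  { rewrite Cinv_circle by assumption.
    split; (eapply is_derive_ext; [intros s; rewrite Cinv_circle by assumption; reflexivity|]);
      simpl; auto_derive; auto; field; lra. }
  induction k as [|k IH].
  - eapply Cderive_value; [exact (Cderive_const (Complex.RtoC 1) t)|].
    change (INR 0) with 0. rewrite Ropp_0. ring.
  - eapply Cderive_value; [apply (Cderive_mult _ _ _ _ _ H1 IH)|].
    rewrite S_INR, !RtoC_opp, RtoC_plus. simpl. ring.
Qed.

Lemma Cmod_sub_ge (r th : R) (l : C) :
  0 < r -> r - Cmod l <= Cmod (circle r th - l)%C.
Proof.
  intros Hr. rewrite <- (Cmod_circle r th Hr) at 1.
  assert (E : circle r th = ((circle r th - l) + l)%C) by ring.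
  rewrite E at 1. generalize (Cmod_triangle (circle r th - l)%C l). lra.
Qed.

Section Contour.

(** One circle encloses the first [N] exponents, so the recurrences in the number of factors
    [n <= N] can be run at a fixed radius. *)
Variables (lam : nat -> C) (r : R) (N : nat).
Hypothesis r_pos : 0 < r.
Hypothesis lam_lt_r : forall j, (j < N)%nat -> Cmod (lam j) < r.

Let w := circle r.

Lemma circle_neq_lam (j : nat) (th : R) : (j < N)%nat -> (w th - lam j)%C <> Complex.RtoC 0.
Proof.
  intros Hj. apply Cmod_gt_0.
  generalize (Cmod_sub_ge r th (lam j) r_pos) (lam_lt_r j Hj). unfold w. lra.
Qed.

Lemma linear_factors_prod_neq_0 (n : nat) (th : R) :
  (n <= N)%nat -> linear_factors_prod lam n (w th) <> Complex.RtoC 0.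
Proof.
  induction n as [|n IH]; intros Hn; simpl.
  - apply C1_nz.
  - apply Cmult_neq_0; [apply IH; lia | apply circle_neq_lam; lia].
Qed.

Lemma Ccontinuous_linear_factors_prod (n : nat) :
  Ccontinuous (fun th => linear_factors_prod lam n (w th)).
Proof.
  induction n as [|n IH]; simpl.
  - apply Ccontinuous_const.
  - apply Ccontinuous_mult; [exact IH|].
    apply Ccontinuous_plus; [apply Ccontinuous_circle | apply Ccontinuous_const].
Qed.

Lemma Ccontinuous_inv_linear_factors_prod (n : nat) :
  (n <= N)%nat -> Ccontinuous (fun th => / linear_factors_prod lam n (w th))%C.
Proof.
  intros Hn. apply Ccontinuous_inv.
  - apply Ccontinuous_linear_factors_prod.
  - intros th; apply linear_factors_prod_neq_0, Hn.
Qed.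

(** Each factor satisfies [Cmod (w - lam j) >= r - Cmod (lam j) > 0] on the circle. The bound is
    uniform in the angle, as the limit argument for [moment] requires. *)
Lemma inv_linear_factors_prod_bounded (n : nat) :
  (n <= N)%nat ->
  exists K, forall th, Cmod (/ linear_factors_prod lam n (w th))%C <= K.
Proof.
  induction n as [|n IH]; intros Hn.
  - exists 1. intros th; simpl. rewrite Cmod_inv, Cmod_1; [lra | apply C1_nz].
  - destruct IH as [K HK]; [lia|].
    assert (Hd : 0 < r - Cmod (lam n)) by (generalize (lam_lt_r n Hn); lra).
    exists (K * / (r - Cmod (lam n))). intros th.
    rewrite Cmod_inv by (apply linear_factors_prod_neq_0, Hn).
    simpl. rewrite Cmod_mult, Rinv_mult.
    specialize (HK th). rewrite Cmod_inv in HK by (apply linear_factors_prod_neq_0; lia).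
    apply Rmult_le_compat; [| |exact HK|].
    + apply Rlt_le, Rinv_0_lt_compat, Cmod_gt_0, linear_factors_prod_neq_0; lia.
    + apply Rlt_le, Rinv_0_lt_compat, Cmod_gt_0, circle_neq_lam; lia.
    + apply Rinv_le_contravar; [exact Hd|]. apply Cmod_sub_ge, r_pos.
Qed.

(** The contour integral of [w^-m] over the product of [n] linear factors, with [Ci * w th] coming
    from [dw]. The case [m = 0] gives the initial values of the fundamental functions; the other [m]
    make the recurrence in [n] close up. *)
Definition moment (n m : nat) : C :=
  Cint (fun th => (Ci * w th * (/ w th) ^ m * / linear_factors_prod lam n (w th))%C).

Lemma Ccontinuous_Cinv_circle : Ccontinuous (fun th => / w th)%C.
Proof.
  apply Ccontinuous_inv; [apply Ccontinuous_circle | intros; apply circle_neq_0, r_pos].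
Qed.

Lemma Ccontinuous_moment (n m : nat) :
  (n <= N)%nat ->
  Ccontinuous (fun th => (Ci * w th * (/ w th) ^ m * / linear_factors_prod lam n (w th))%C).
Proof.
  intros Hn. apply Ccontinuous_mult.
  - apply Ccontinuous_mult.
    + apply Ccontinuous_mult; [apply Ccontinuous_const | apply Ccontinuous_circle].
    + apply Ccontinuous_pow, Ccontinuous_Cinv_circle.
  - apply Ccontinuous_inv_linear_factors_prod, Hn.
Qed.

(* [1/(w - l) = 1/w + l/(w (w - l))] *)
Lemma moment_S (n m : nat) :
  (S n <= N)%nat -> moment (S n) m = (moment n (S m) + lam n * moment (S n) (S m))%C.
Proof.
  intros Hn. unfold moment.
  rewrite <- Cint_scal by (apply Ccontinuous_moment; lia).
  rewrite <- Cint_plus.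
  - apply Cint_ext; intros th. simpl linear_factors_prod. simpl Cpow.
    field. repeat split; first [apply circle_neq_lam; lia
      | apply linear_factors_prod_neq_0; lia | apply circle_neq_0, r_pos].
  - apply Ccontinuous_moment; lia.
  - apply Ccontinuous_mult; [apply Ccontinuous_const | apply Ccontinuous_moment; lia].
Qed.

(** Among the powers [w^-m] only [w^-1] has no primitive along the closed circle; its integrand is
    the constant [Ci] over a full turn. *)
Lemma moment_0 (m : nat) :
  moment 0 m = if Nat.eqb m 1 then (Complex.RtoC (2 * PI) * Ci)%C else Complex.RtoC 0.
Proof.
  unfold moment; simpl linear_factors_prod.
  destruct m as [|[|m]]; simpl Nat.eqb; cbv iota.
  - rewrite (Cint_ext _ (fun th => Ci * w th)%C) by (intros th; simpl; field).
    apply (Cint_Cderive_periodic w).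
    + apply Cderive_circle.
    + apply Ccontinuous_mult; [apply Ccontinuous_const | apply Ccontinuous_circle].
    + apply circle_periodic.
  - rewrite (Cint_ext _ (fun th => Ci)%C)
      by (intros th; simpl; field; apply circle_neq_0, r_pos).
    unfold Cint. rewrite !RInt_const.
    apply injective_projections; unfold scal; simpl; unfold mult; simpl; ring.
  - assert (Hm : Complex.RtoC (- INR (S m)) <> Complex.RtoC 0).
    { intros E; apply RtoC_inj in E. generalize (pos_INR m). rewrite S_INR in E. lra. }
    (* The exponent is now [S (S m)], and the primitive is [(/ w th) ^ S m] divided by
       [- INR (S m)]. *)
    rewrite (Cint_ext _ (fun th => (/ Complex.RtoC (- INR (S m))) *
      (Complex.RtoC (- INR (S m)) * (Ci * (/ w th) ^ (S m))))%C).
    2:{ intros th. simpl Cpow. field. split; first [exact Hm | apply circle_neq_0, r_pos]. }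
    assert (Hc : Ccontinuous (fun th => Complex.RtoC (- INR (S m)) * (Ci * (/ w th) ^ (S m)))%C).
    { apply Ccontinuous_mult; [apply Ccontinuous_const|].
      apply Ccontinuous_mult; [apply Ccontinuous_const|].
      apply Ccontinuous_pow, Ccontinuous_Cinv_circle. }
    rewrite Cint_scal by exact Hc.
    rewrite (Cint_Cderive_periodic (fun th => (/ w th) ^ S m)%C); [ring| |exact Hc|].
    + intros t. apply Cderive_Cinv_circle_pow, r_pos.
    + unfold w. rewrite circle_periodic. reflexivity.
Qed.

(* Iterating [moment_S] gives [moment (S n) m = lam n ^ k * moment (S n) (m + k)],
   which is O((|lam n| / r) ^ k). *)
Lemma moment_high (n m : nat) :
  (n <= N)%nat -> (2 <= n + m)%nat -> moment n m = Complex.RtoC 0.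
Proof.
  revert m; induction n as [|n IH]; intros m Hn Hm.
  - rewrite moment_0. destruct m as [|[|m]]; [lia|lia|reflexivity].
  - assert (Hit : forall k, moment (S n) m = ((lam n) ^ k * moment (S n) (m + k))%C).
    { induction k as [|k IHk].
      - rewrite Nat.add_0_r. simpl. ring.
      - rewrite IHk, moment_S by lia. rewrite IH by lia.
        replace (m + S k)%nat with (S (m + k)) by lia. simpl. ring. }
    destruct (inv_linear_factors_prod_bounded (S n) Hn) as [K HK].
    assert (Hb : forall k, Cmod (moment (S n) m) <=
      (Cmod (lam n) / r) ^ k * (4 * PI * (r * (/ r) ^ m * K))).
    { intros k. rewrite (Hit k), Cmod_mult, Cmod_pow.
      unfold Rdiv. rewrite Rpow_mult_distr, Rmult_assoc.
      apply Rmult_le_compat_l; [apply pow_le, Cmod_ge_0|].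
      eapply Rle_trans; [apply (Cmod_Cint_le _ (r * (/ r) ^ (m + k) * K))|].
      - apply Ccontinuous_moment, Hn.
      - intros t. rewrite !Cmod_mult, Cmod_Ci, Cmod_pow, Cmod_inv by (apply circle_neq_0, r_pos).
        unfold w at 1 2. rewrite Cmod_circle by exact r_pos.
        rewrite Rmult_1_l. apply Rmult_le_compat_l; [|apply HK].
        apply Rmult_le_pos; [lra|]. apply pow_le, Rlt_le, Rinv_0_lt_compat, r_pos.
      - rewrite pow_add. apply Req_le. ring. }
    assert (Hq : Rabs (Cmod (lam n) / r) < 1).
    { rewrite Rabs_pos_eq.
      - apply Rmult_lt_reg_r with r; [exact r_pos|]. unfold Rdiv.
        rewrite Rmult_assoc, Rinv_l by lra. generalize (lam_lt_r n Hn); lra.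
      - apply Rdiv_le_0_compat; [apply Cmod_ge_0 | exact r_pos]. }
    apply Cmod_eq_0, Rle_antisym; [|apply Cmod_ge_0].
    change (Rbar_le (Cmod (moment (S n) m)) 0).
    apply (is_lim_seq_le (fun _ => Cmod (moment (S n) m)) _ _ _ Hb).
    + apply is_lim_seq_const.
    + replace (Finite 0) with (Rbar_mult 0 (4 * PI * (r * (/ r) ^ m * K)))
        by (simpl; f_equal; ring).
      apply is_lim_seq_scal_r, is_lim_seq_geom, Hq.
Qed.

(* Here [n] counts factors: [Phi lam n] corresponds to [Phi_circle (S n)]. *)
Definition Phi_circle (n : nat) (u : R) : C :=
  ((0%R, (- / (2 * PI))%R) *
   Cint (fun th => Cexp (Complex.RtoC u * w th) *
     (Ci * w th * / linear_factors_prod lam n (w th))))%C.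

Lemma Ccontinuous_kernel (n : nat) :
  (n <= N)%nat -> Ccontinuous (fun th => Ci * w th * / linear_factors_prod lam n (w th))%C.
Proof.
  intros Hn. apply Ccontinuous_mult.
  - apply Ccontinuous_mult; [apply Ccontinuous_const | apply Ccontinuous_circle].
  - apply Ccontinuous_inv_linear_factors_prod, Hn.
Qed.

Lemma Ccontinuous_Cexp_circle (u : R) : Ccontinuous (fun th => Cexp (Complex.RtoC u * w th)%C).
Proof.
  apply Ccontinuous_Cexp, Ccontinuous_mult; [apply Ccontinuous_const | apply Ccontinuous_circle].
Qed.

(** Base of the recurrence: without factors the integrand has the primitive [exp (u w) / u] along
    the closed circle, or [w] when [u = 0]. *)
Lemma Phi_circle_0_factors (u : R) : Phi_circle 0 u = Complex.RtoC 0.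
Proof.
  unfold Phi_circle. cbn [linear_factors_prod].
  rewrite (Cint_ext _ (fun th => Cexp (Complex.RtoC u * w th) * (Ci * w th))%C)
    by (intros th; field).
  assert (Hc : Ccontinuous (fun th => Cexp (Complex.RtoC u * w th) * (Ci * w th))%C).
  { apply Ccontinuous_mult; [apply Ccontinuous_Cexp_circle|].
    apply Ccontinuous_mult; [apply Ccontinuous_const | apply Ccontinuous_circle]. }
  destruct (Req_dec u 0) as [->|Hu].
  - rewrite (Cint_Cderive_periodic w); [ring| |exact Hc|apply circle_periodic].
    intros t. eapply Cderive_value; [apply Cderive_circle|].
    replace (Complex.RtoC 0 * w t)%C with (Complex.RtoC 0) by ring.
    rewrite Cexp_0. unfold w. ring.
  - assert (Hu' : Complex.RtoC u <> Complex.RtoC 0) by (intros E; apply Hu, RtoC_inj, E).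
    assert (Hz : Cint (fun th => Complex.RtoC u * (Cexp (Complex.RtoC u * w th) * (Ci * w th)))%C
        = Complex.RtoC 0).
    { apply (Cint_Cderive_periodic (fun th => Cexp (Complex.RtoC u * w th)%C)).
      - intros t. eapply Cderive_value.
        + apply Cderive_Cexp, Cderive_scal, Cderive_circle.
        + unfold w. ring.
      - apply Ccontinuous_mult; [apply Ccontinuous_const | exact Hc].
      - unfold w. rewrite circle_periodic. reflexivity. }
    rewrite Cint_scal in Hz by exact Hc.
    replace (Cint _) with (/ Complex.RtoC u * (Complex.RtoC u *
      Cint (fun th => Cexp (Complex.RtoC u * w th) * (Ci * w th))))%C by (field; exact Hu').
    rewrite Hz. ring.
Qed.

(** At [u = 0] the integral is [moment (S n) 0]. With two or more factors it vanishes by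
    [moment_high]; with one factor, [moment_S] leaves only [moment 0 1], that is [2 PI i]. *)
Lemma Phi_circle_at_0 (n : nat) :
  (S n <= N)%nat ->
  Phi_circle (S n) 0 = if Nat.eqb n 0 then Complex.RtoC 1 else Complex.RtoC 0.
Proof.
  intros Hn.
  assert (E : Phi_circle (S n) 0 = ((0%R, (- / (2 * PI))%R) * moment (S n) 0)%C).
  { unfold Phi_circle, moment. f_equal. apply Cint_ext. intros th.
    replace (Complex.RtoC 0 * w th)%C with (Complex.RtoC 0) by ring.
    rewrite Cexp_0. simpl Cpow. ring. }
  rewrite E. generalize PI_neq0; intros HPI. destruct n as [|n]; simpl Nat.eqb; cbv iota.
  - rewrite moment_S, moment_0, moment_high by lia. simpl Nat.eqb; cbv iota.
    apply injective_projections; simpl; field; exact HPI.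
  - rewrite moment_high by lia. ring.
Qed.

(** Differentiation multiplies the integrand by [w = (w - lam n) + lam n]; the first summand cancels
    the last linear factor. *)
Lemma Cderive_Phi_circle (n : nat) (u : R) :
  (S n <= N)%nat ->
  Cderive (Phi_circle (S n)) u (Phi_circle n u + lam n * Phi_circle (S n) u)%C.
Proof.
  intros Hn. eapply Cderive_value.
  - apply Cderive_scal, Cderive_Cint_Cexp; [apply Ccontinuous_circle | apply Ccontinuous_kernel, Hn].
  - unfold Phi_circle.
    transitivity ((0%R, (- / (2 * PI))%R) *
      (Cint (fun th => Cexp (Complex.RtoC u * w th) *
         (Ci * w th * / linear_factors_prod lam n (w th))) +
       lam n * Cint (fun th => Cexp (Complex.RtoC u * w th) *
         (Ci * w th * / linear_factors_prod lam (S n) (w th)))))%C; [f_equal | ring].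
    assert (Hc : forall k, (k <= N)%nat -> Ccontinuous (fun th => Cexp (Complex.RtoC u * w th) *
         (Ci * w th * / linear_factors_prod lam k (w th)))%C).
    { intros k Hk. apply Ccontinuous_mult;
        [apply Ccontinuous_Cexp_circle | apply Ccontinuous_kernel, Hk]. }
    rewrite <- Cint_scal by (apply Hc; lia).
    rewrite <- Cint_plus.
    + apply Cint_ext. intros th. simpl linear_factors_prod. field.
      split; first [apply circle_neq_lam; lia | apply linear_factors_prod_neq_0; lia].
    + apply Hc; lia.
    + apply Ccontinuous_mult; [apply Ccontinuous_const | apply Hc; lia].
Qed.

End Contour.

(** * The radius chosen in [Phi] *)

Lemma sum_norm_ge (lam : nat -> C) (n j : nat) : (j <= n)%nat -> Cmod (lam j) <= sum_norm lam n.
Proof.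
  assert (P : forall m, 0 <= sum_norm lam m).
  { induction m; simpl; rewrite Cnorm_Cmod; generalize (Cmod_ge_0 (lam 0%nat)); [lra|].
    generalize (Cmod_ge_0 (lam (S m))); lra. }
  induction n as [|n IH]; intros Hj; simpl; rewrite Cnorm_Cmod.
  - replace j with O by lia. lra.
  - destruct (Nat.eq_dec j (S n)) as [->|Hne].
    + generalize (P n); lra.
    + generalize (IH ltac:(lia)) (Cmod_ge_0 (lam (S n))). lra.
Qed.

Lemma sum_norm_radius (lam : nat -> C) (n j : nat) :
  (j < S n)%nat -> Cmod (lam j) < 1 + sum_norm lam n.
Proof. intros Hj. generalize (sum_norm_ge lam n j ltac:(lia)). lra. Qed.

Lemma sum_norm_radius_pos (lam : nat -> C) (n : nat) : 0 < 1 + sum_norm lam n.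
Proof. generalize (sum_norm_ge lam n 0 ltac:(lia)) (Cmod_ge_0 (lam 0%nat)). lra. Qed.

Lemma Phi_Phi_circle (lam : nat -> C) (n : nat) (u : R) :
  Phi lam n (Defs.RtoC u) = Phi_circle lam (1 + sum_norm lam n) (S n) u.
Proof.
  set (r := 1 + sum_norm lam n).
  assert (Hr : 0 < r) by apply sum_norm_radius_pos.
  unfold Phi, Phi_circle. fold r.
  change Defs.Cmul with Complex.Cmult. f_equal.
  rewrite <- CInt_Cint.
  - unfold CInt.
    assert (E : forall th, Cmult
        (Defs.Cdiv (Cexp (Cmult (Defs.RtoC u) (r * cos th, r * sin th)))
          (Cprod_lam lam (r * cos th, r * sin th) n)) (Cmult (0, 1) (r * cos th, r * sin th))
      = (Cexp (Complex.RtoC u * circle r th) *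
         (Ci * circle r th * / linear_factors_prod lam (S n) (circle r th)))%C).
    { intros th. unfold Defs.Cdiv. rewrite Cinv_Coquelicot, Cprod_lam_linear_factors.
      fold (circle r th). change (Defs.RtoC u) with (Complex.RtoC u).
      change Defs.Cmul with Complex.Cmult. change (0, 1) with Ci. ring. }
    f_equal; f_equal; apply functional_extensionality;
      intros th; rewrite E; reflexivity.
  - apply Ccontinuous_mult; [apply Ccontinuous_Cexp_circle|].
    apply (Ccontinuous_kernel lam r (S n)); auto.
    apply sum_norm_radius.
Qed.

(** * Taylor expansion with respect to the fundamental functions *)

(* Differentiate [s |-> exp ((u - s) l) * y s] on [0, u]. *)
Lemma linear_ode_bound (y g : R -> C) (l : C) (M u : R) (P P' : R -> R) :
  0 <= u -> Cmod l <= M ->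
  (forall s, 0 <= s <= u -> Cderive y s (g s + l * y s)%C) ->
  (forall s, 0 <= s <= u -> is_derive P s (P' s)) ->
  (forall s, 0 <= s <= u -> Cmod (g s) <= exp (M * s) * P' s) ->
  Cmod (y u - Cexp (Complex.RtoC u * l) * y 0%R)%C <= exp (M * u) * (P u - P 0).
Proof.
  intros Hu Hl Hy HP Hg.
  set (h := fun s : R => (Cexp (Complex.RtoC (u - s) * l) * y s)%C).
  assert (Eu : h u = y u).
  { unfold h. rewrite Rminus_diag.
    replace (Complex.RtoC 0 * l)%C with (Complex.RtoC 0) by ring. rewrite Cexp_0. ring. }
  assert (E0 : h 0 = (Cexp (Complex.RtoC u * l) * y 0%R)%C).
  { unfold h. rewrite Rminus_0_r. reflexivity. }
  rewrite <- E0, <- Eu.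
  replace (exp (M * u) * (P u - P 0)) with (exp (M * u) * P u - exp (M * u) * P 0) by ring.
  apply (Cderive_mean_value_le h (fun s => Cexp (Complex.RtoC (u - s) * l) * g s)%C
    (fun s => exp (M * u) * P s) (fun s => exp (M * u) * P' s)); [exact Hu| | |].
  - intros s Hs. eapply Cderive_value.
    + apply (Cderive_mult (fun s => Cexp (Complex.RtoC (u - s) * l)%C)).
      * apply (Cderive_comp_sub (fun v => Cexp (Complex.RtoC v * l)%C)), Cderive_Cexp_lin.
      * apply Hy, Hs.
    + simpl. ring.
  - intros s Hs. apply is_derive_scal, HP, Hs.
  - intros s Hs. rewrite Cmod_mult, Cmod_Cexp.
    replace (exp (M * u)) with (exp (M * (u - s)) * exp (M * s))
      by (rewrite <- exp_plus; f_equal; ring).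
    rewrite Rmult_assoc. apply Rmult_le_compat; [apply Rlt_le, exp_pos | apply Cmod_ge_0 | |apply Hg, Hs].
    assert (Hl1 : fst l <= M).
    { generalize (re_le_Cmod l) (Rle_abs (Re l)). unfold Re. lra. }
    assert (Hle : fst (Complex.RtoC (u - s) * l)%C <= M * (u - s)) by (simpl; nra).
    destruct Hle as [Hlt|Heq]; [apply Rlt_le, exp_increasing, Hlt | rewrite Heq; lra].
Qed.

(** Induction through [linear_ode_bound]: the bound at [n] is [exp (M * s)] times the derivative of
    [s ^ S n / INR (fact (S n))], and the initial value at [S n] is zero. *)
Lemma Phi_circle_bound (lam : nat -> C) (r : R) (N : nat) (M : R) :
  0 < r -> (forall j, (j < N)%nat -> Cmod (lam j) < r) ->
  forall n, (S n <= N)%nat -> (forall j, (j <= n)%nat -> Cmod (lam j) <= M) ->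
  forall u, 0 <= u ->
  Cmod (Phi_circle lam r (S n) u) <= exp (M * u) * (u ^ n / INR (fact n)).
Proof.
  intros Hr Hlam. induction n as [|n IH]; intros Hn HM u Hu.
  (* The forcing term [Phi_circle lam r 0] vanishes, so [P = 0] is allowed and forces
     [Phi_circle lam r 1 u = Cexp (u * lam O)]. *)
  - assert (H := linear_ode_bound (Phi_circle lam r 1) (Phi_circle lam r 0) (lam O) M u
      (fun _ => 0) (fun _ => 0) Hu (HM O (le_n _))).
    rewrite (Phi_circle_at_0 lam r N) in H by assumption. simpl Nat.eqb in H; cbv iota in H.
    replace (Phi_circle lam r 1 u) with
      ((Phi_circle lam r 1 u - Cexp (Complex.RtoC u * lam O) * Complex.RtoC 1)
        + Cexp (Complex.RtoC u * lam O))%C by ring.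
    eapply Rle_trans; [apply Cmod_triangle|].
    assert (H1 : Cmod (Cexp (Complex.RtoC u * lam O)%C) <= exp (M * u)).
    { rewrite Cmod_Cexp.
      assert (Hle : fst (Complex.RtoC u * lam O)%C <= M * u).
      { generalize (HM O (le_n _)) (re_le_Cmod (lam O)) (Rle_abs (Re (lam O))).
        unfold Re; simpl. intros. nra. }
      destruct Hle as [Hlt|Heq]; [apply Rlt_le, exp_increasing, Hlt | rewrite Heq; lra]. }
    assert (H2 : exp (M * u) * (u ^ 0 / INR (fact 0)) = exp (M * u)) by (simpl; field).
    rewrite H2. rewrite Rminus_diag, Rmult_0_r in H.
    cut (Cmod (Phi_circle lam r 1 u - Cexp (Complex.RtoC u * lam O) * Complex.RtoC 1)%C <= 0); [lra|].
    apply H.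
    + intros s _. apply (Cderive_Phi_circle lam r N); assumption.
    + intros s _. apply (is_derive_const (V := R_NormedModule)).
    + intros s _. rewrite Phi_circle_0_factors, Cmod_0 by exact Hr. lra.
  - assert (Hf : INR (fact n) <> 0) by apply INR_fact_neq_0.
    assert (HSn : INR (S n) <> 0) by (apply not_0_INR; lia).
    assert (H := linear_ode_bound (Phi_circle lam r (S (S n))) (Phi_circle lam r (S n))
      (lam (S n)) M u (fun s => s ^ S n / INR (fact (S n))) (fun s => s ^ n / INR (fact n))
      Hu (HM _ (le_n _))).
    rewrite (Phi_circle_at_0 lam r N) in H by assumption. simpl Nat.eqb in H; cbv iota in H.
    rewrite Cmult_0_r in H. unfold Cminus in H. rewrite Copp_0, Cplus_0_r in H.
    rewrite (pow_i (S n)) in H by lia.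
    replace (u ^ S n / INR (fact (S n)))
      with (u ^ S n / INR (fact (S n)) - 0 / INR (fact (S n))) by (unfold Rdiv; ring).
    apply H.
    + intros s _. apply (Cderive_Phi_circle lam r N); assumption.
    + intros s _. rewrite fact_simpl, mult_INR.
      auto_derive; [exact I|]. simpl Nat.pred. field. split; assumption.
    + intros s Hs. apply IH; [lia | intros; apply HM; lia | lra].
Qed.

(** The difference for the two radii has zero forcing term by induction and zero initial value by
    [Phi_circle_at_0], so [linear_ode_bound] with [P = 0] makes it vanish. *)
Lemma Phi_circle_radius_indep (lam : nat -> C) (r r' : R) (N : nat) :
  0 < r -> (forall j, (j < N)%nat -> Cmod (lam j) < r) ->
  0 < r' -> (forall j, (j < N)%nat -> Cmod (lam j) < r') ->
  forall n, (n <= N)%nat -> forall u, 0 <= u -> Phi_circle lam r n u = Phi_circle lam r' n u.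
Proof.
  intros Hr Hlam Hr' Hlam'. induction n as [|n IH]; intros Hn u Hu.
  - rewrite !Phi_circle_0_factors by assumption. reflexivity.
  - assert (H := linear_ode_bound
      (fun s => Phi_circle lam r (S n) s + - Complex.RtoC 1 * Phi_circle lam r' (S n) s)%C
      (fun s => Phi_circle lam r n s + - Complex.RtoC 1 * Phi_circle lam r' n s)%C
      (lam n) (Cmod (lam n)) u (fun _ => 0) (fun _ => 0) Hu (Rle_refl _)).
    cbv beta in H.
    rewrite !(Phi_circle_at_0 lam _ N) in H by assumption.
    rewrite Rminus_diag, Rmult_0_r in H.
    assert (Z : (Phi_circle lam r (S n) u + - Complex.RtoC 1 * Phi_circle lam r' (S n) u)%C
      = Complex.RtoC 0).
    { apply Cmod_eq_0, Rle_antisym; [|apply Cmod_ge_0].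
      eapply Rle_trans; [|apply H].
      - apply Req_le. f_equal. ring.
      - intros s _. eapply Cderive_value.
        + apply Cderive_plus; [|apply Cderive_scal];
            apply (Cderive_Phi_circle lam _ N); assumption.
        + ring.
      - intros s _. apply (is_derive_const (V := R_NormedModule)).
      - intros s Hs. rewrite IH by (lia || lra).
        replace (_ + _)%C with (Complex.RtoC 0) by ring.
        rewrite Cmod_0. lra. }
    replace (Phi_circle lam r (S n) u) with
      ((Phi_circle lam r (S n) u + - Complex.RtoC 1 * Phi_circle lam r' (S n) u)
        + Phi_circle lam r' (S n) u)%C by ring.
    rewrite Z. ring.
Qed.

(** Continuation by the tangent lines at the endpoints turns one-sided derivatives there into
    two-sided ones, as [is_derive] demands. *)
Definition affine_extension (g g' : R -> R) (a b t : R) : R :=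
  if Rlt_dec t a then g a + g' a * (t - a)
  else if Rlt_dec b t then g b + g' b * (t - b) else g t.

Lemma affine_extension_inside (g g' : R -> R) (a b t : R) :
  a <= t <= b -> affine_extension g g' a b t = g t.
Proof.
  intros Ht. unfold affine_extension.
  destruct (Rlt_dec t a); [lra|]. destruct (Rlt_dec b t); [lra|reflexivity].
Qed.

Lemma is_derive_affine_extension (g g' : R -> R) (a b t : R) :
  has_deriv_on g g' a b -> a <= t <= b -> is_derive (affine_extension g g' a b) t (g' t).
Proof.
  intros Hg Ht. apply is_derive_Reals. intros eps Heps.
  destruct (Hg t Ht eps Heps) as [d [Hd Hdq]].
  (* With [h] below [da] and [db], the point [t + h] can leave the interval only through an endpoint
     equal to [t]; there the difference quotient is exactly [g' t]. *)
  set (da := if Req_dec_T t a then d else t - a).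
  set (db := if Req_dec_T t b then d else b - t).
  assert (Hda : 0 < da) by (unfold da; destruct (Req_dec_T t a); lra).
  assert (Hdb : 0 < db) by (unfold db; destruct (Req_dec_T t b); lra).
  assert (Hm : 0 < Rmin d (Rmin da db)) by (repeat apply Rmin_glb_lt; assumption).
  exists (mkposreal _ Hm). simpl. intros h Hh Hlt.
  assert (H1 : Rabs h < d) by (eapply Rlt_le_trans; [exact Hlt | apply Rmin_l]).
  assert (H2 : Rabs h < da)
    by (eapply Rlt_le_trans; [exact Hlt | eapply Rle_trans; [apply Rmin_r | apply Rmin_l]]).
  assert (H3 : Rabs h < db)
    by (eapply Rlt_le_trans; [exact Hlt | eapply Rle_trans; [apply Rmin_r | apply Rmin_r]]).
  assert (Hh1 := Rle_abs h). assert (Hh2 := Rle_abs (- h)). rewrite Rabs_Ropp in Hh2.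
  rewrite (affine_extension_inside g g' a b t Ht).
  unfold affine_extension.
  destruct (Rlt_dec (t + h) a) as [L|L].
  - assert (E : t = a) by (unfold da in H2; destruct (Req_dec_T t a); lra). subst t.
    replace ((g a + g' a * (a + h - a) - g a) / h - g' a) with 0 by (field; exact Hh).
    rewrite Rabs_R0. exact Heps.
  - destruct (Rlt_dec b (t + h)) as [L'|L'].
    + assert (E : t = b) by (unfold db in H3; destruct (Req_dec_T t b); lra). subst t.
      replace ((g b + g' b * (b + h - b) - g b) / h - g' b) with 0 by (field; exact Hh).
      rewrite Rabs_R0. exact Heps.
    + apply Hdq; [exact Hh | exact H1 | lra].
Qed.

Definition Caffine_extension (g g' : R -> C) (a b t : R) : C :=
  (affine_extension (fun s => fst (g s)) (fun s => fst (g' s)) a b t,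
   affine_extension (fun s => snd (g s)) (fun s => snd (g' s)) a b t).

Lemma Caffine_extension_inside (g g' : R -> C) (a b t : R) :
  a <= t <= b -> Caffine_extension g g' a b t = g t.
Proof. intros Ht. apply injective_projections; apply affine_extension_inside; exact Ht. Qed.

Lemma Cderive_affine_extension (g g' : R -> C) (a b t : R) :
  Chas_deriv_on g g' a b -> a <= t <= b -> Cderive (Caffine_extension g g' a b) t (g' t).
Proof.
  intros [H1 H2] Ht.
  split; [exact (is_derive_affine_extension _ _ _ _ _ H1 Ht)
         | exact (is_derive_affine_extension _ _ _ _ _ H2 Ht)].
Qed.

Lemma Chas_deriv_on_subinterval (g g' : R -> C) (a b a' b' : R) :
  Chas_deriv_on g g' a b -> a <= a' -> b' <= b -> Chas_deriv_on g g' a' b'.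
Proof.
  intros [H1 H2] Ha Hb; split; intros t Ht eps Heps;
    [destruct (H1 t ltac:(lra) eps Heps) as [d [Hd H]]
    | destruct (H2 t ltac:(lra) eps Heps) as [d [Hd H]]];
    exists d; (split; [exact Hd|]); intros h Hh Hlt Hth; apply H; auto; lra.
Qed.

(** * The Taylor sum and its remainder *)

Lemma Csum_ext (F G : nat -> C) (n : nat) :
  (forall k, (k < n)%nat -> F k = G k) -> Csum F n = Csum G n.
Proof.
  induction n as [|n IH]; intros H; simpl; [reflexivity|].
  rewrite IH by (intros; apply H; lia). rewrite (H n) by lia. reflexivity.
Qed.

Lemma Csum_first_term (F : nat -> C) (n : nat) :
  (forall k, (0 < k)%nat -> F k = Complex.RtoC 0) -> Csum F (S n) = F O.
Proof.
  intros H. induction n as [|n IH].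
  - apply Cplus_0_l.
  - change (Cplus (Csum F (S n)) (F (S n)) = F O). rewrite IH, (H (S n)) by lia. apply Cplus_0_r.
Qed.

(* Telescoping: each term contributes
   [D (k+1) t * Phi_k (x - t) - D k t * Phi_(k-1) (x - t)]. *)
Lemma Cderive_Taylor_sum (lam : nat -> C) (r : R) (N : nat) (E : nat -> R -> C)
    (D : nat -> C) (x t : R) :
  0 < r -> (forall j, (j < N)%nat -> Cmod (lam j) < r) ->
  (forall k, E k t = D k) ->
  (forall k, Cderive (E k) t (D (S k) + lam k * D k)%C) ->
  forall n, (n <= N)%nat ->
  Cderive (fun s => Csum (fun k => E k s * Phi_circle lam r (S k) (x - s))%C n) t
    (D n * Phi_circle lam r n (x - t))%C.
Proof.
  intros Hr Hlam HE HD. induction n as [|n IH]; intros Hn.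
  - eapply Cderive_value; [exact (Cderive_const (Complex.RtoC 0) t)|].
    rewrite Phi_circle_0_factors by exact Hr. ring.
  - eapply Cderive_value.
    + apply (Cderive_plus (fun s => Csum (fun k => E k s * Phi_circle lam r (S k) (x - s))%C n)
        (fun s => E n s * Phi_circle lam r (S n) (x - s))%C); [apply IH; lia|].
      apply (Cderive_mult (E n) (fun s => Phi_circle lam r (S n) (x - s))); [apply HD|].
      apply Cderive_comp_sub, (Cderive_Phi_circle lam r N); assumption.
    + cbv beta. rewrite HE. ring.
Qed.

(** The mean value inequality for the Taylor sum [G] as a function of its base point replaces the
    integral remainder: the derivative of [G] is bounded by a constant [K] on the whole interval. *)
Lemma Taylor_remainder_bound (lam : nat -> C) (D : nat -> R -> C) (a x M B : R) (n : nat) :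
  a <= x ->
  (forall k, Chas_deriv_on (D k) (fun t => Cadd (D (S k) t) (Cmul (lam k) (D k t))) a x) ->
  (forall j, (j <= n)%nat -> Cmod (lam j) <= M) ->
  (forall t, a <= t <= x -> Cmod (D (S n) t) <= B) ->
  Cmod (Csum (fun k => Cmul (D k a) (Phi lam k (Defs.RtoC (x - a)))) (S n) - D O x)%C
  <= B * (exp (M * (x - a)) * ((x - a) ^ n / INR (fact n))) * (x - a).
Proof.
  intros Hax HD HM HB.
  (* A single radius for all [k <= n]; each [Phi lam k] carries its own radius and is moved to [r]
     by [Phi_circle_radius_indep]. *)
  set (r := 1 + sum_norm lam n).
  assert (Hr : 0 < r) by apply sum_norm_radius_pos.
  assert (Hlam : forall j, (j < S n)%nat -> Cmod (lam j) < r) by apply sum_norm_radius.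
  assert (HB0 : 0 <= B) by (eapply Rle_trans; [apply Cmod_ge_0 | apply (HB a); lra]).
  assert (HM0 : 0 <= M) by (eapply Rle_trans; [apply Cmod_ge_0 | apply (HM O); lia]).
  set (E := fun k => Caffine_extension (D k)
    (fun t => Cadd (D (S k) t) (Cmul (lam k) (D k t))) a x).
  assert (HE : forall k t, a <= t <= x -> E k t = D k t)
    by (intros; apply Caffine_extension_inside; assumption).
  set (G := fun s => Csum (fun k => E k s * Phi_circle lam r (S k) (x - s))%C (S n)).
  assert (Ga : G a = Csum (fun k => Cmul (D k a) (Phi lam k (Defs.RtoC (x - a)))) (S n)).
  { apply Csum_ext. intros k Hk. rewrite Phi_Phi_circle.
    rewrite HE by lra.
    rewrite (Phi_circle_radius_indep lam r (1 + sum_norm lam k) (S k)); try lia; try lra.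
    - reflexivity.
    - intros j Hj; apply Hlam; lia.
    - apply sum_norm_radius_pos.
    - apply sum_norm_radius. }
  assert (Gx : G x = D O x).
  (* At base point [x] every fundamental function is evaluated at 0, so only the term [k = 0]
     survives. *)
  { unfold G. rewrite Rminus_diag.
    rewrite (Csum_ext _ (fun k => D k x * (if Nat.eqb k 0 then Complex.RtoC 1
      else Complex.RtoC 0))%C).
    - rewrite Csum_first_term; [apply Cmult_1_r|].
      intros [|k] Hk; [lia|]. simpl Nat.eqb; cbv iota. apply Cmult_0_r.
    - intros k Hk. rewrite (Phi_circle_at_0 lam r (S n)) by (assumption || lia).
      rewrite HE by lra. reflexivity. }
  rewrite <- Ga, <- Gx.
  replace (G a - G x)%C with (- (G x - G a))%C by ring. rewrite Cmod_opp.
  set (K := B * (exp (M * (x - a)) * ((x - a) ^ n / INR (fact n)))).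
  replace (K * (x - a)) with (K * x - K * a) by ring.
  apply (Cderive_mean_value_le G (fun t => D (S n) t * Phi_circle lam r (S n) (x - t))%C
    (fun t => K * t) (fun _ => K)); [exact Hax| | |].
  - intros t Ht. apply (Cderive_Taylor_sum lam r (S n) E (fun k => D k t)); auto.
    intros k; apply (Cderive_affine_extension (D k)
      (fun t => Cadd (D (S k) t) (Cmul (lam k) (D k t)))); [apply HD | exact Ht].
  - intros t _. auto_derive; [exact I | ring].
  - intros t Ht. rewrite Cmod_mult. unfold K.
    apply Rmult_le_compat; try apply Cmod_ge_0; [apply HB, Ht|].
    eapply Rle_trans; [apply (Phi_circle_bound lam r (S n) M); auto; lra|].
    apply Rmult_le_compat.
    + apply Rlt_le, exp_pos.
    + apply Rdiv_le_0_compat; [apply pow_le; lra | apply INR_fact_lt_0].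
    + assert (Hle : M * (x - t) <= M * (x - a)) by nra.
      destruct Hle as [Hlt|Heq]; [apply Rlt_le, exp_increasing, Hlt | rewrite Heq; lra].
    + apply Rmult_le_compat_r; [apply Rlt_le, Rinv_0_lt_compat, INR_fact_lt_0|].
      apply pow_incr; lra.
Qed.

(** * Growth of the exponents and convergence *)

Lemma lam_linear_growth (lam : nat -> C) (c : R) (N : nat) :
  0 <= c ->
  (forall n, (N <= n)%nat -> Cmod (lam n) / INR n <= c) ->
  exists M, 0 <= M /\ forall j n, (j <= n)%nat -> Cmod (lam j) <= M + c * INR n.
Proof.
  intros Hc H.
  assert (HM : 0 <= sum_norm lam N)
    by (eapply Rle_trans; [apply Cmod_ge_0 | apply (sum_norm_ge lam N 0); lia]).
  (* This sum dominates the finitely many [lam j] with [j <= N]; for larger [j] the quotient bound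
     applies, with [INR j] positive and at most [INR n]. *)
  exists (sum_norm lam N). split; [exact HM|].
  intros j n Hj. assert (Hjn := le_INR j n Hj). assert (Hj0 := pos_INR j).
  destruct (Nat.le_gt_cases j N) as [L|L].
  - generalize (sum_norm_ge lam N j L). nra.
  - assert (Hp : 0 < INR j) by (apply lt_0_INR; lia).
    assert (Hq := H j ltac:(lia)).
    assert (Cmod (lam j) <= c * INR j).
    { replace (Cmod (lam j)) with (Cmod (lam j) / INR j * INR j) by (field; lra).
      apply Rmult_le_compat_r; lra. }
    nra.
Qed.

(** Half of the power absorbs the linear factor, since [m / 2^m <= 1]. *)
Lemma INR_mult_half_pow_le (n : nat) : INR (2 * n) * (/ 2) ^ (2 * n) <= 2 * (/ 2) ^ n.
Proof.
  assert (H : forall m, INR m * (/ 2) ^ m <= 1).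
  { induction m as [|m IH]; [simpl; lra|].
    assert (P : 0 < (/ 2) ^ m) by (apply pow_lt; lra).
    assert (Q : (/ 2) ^ m <= 1).
    { rewrite <- (pow1 m). apply pow_incr; lra. }
    rewrite S_INR. simpl pow. nra. }
  replace (2 * n)%nat with (n + n)%nat by lia.
  rewrite pow_add, plus_INR.
  assert (P : 0 < (/ 2) ^ n) by (apply pow_lt; lra).
  specialize (H n). nra.
Qed.

Theorem mainTheorem8 :
  forall (lam : nat -> Cplx) (beta : R),
    0 <= beta ->
    (* limsup_{n -> oo} |lam n| / n <= beta *)
    (forall eps, 0 < eps -> exists N : nat,
        forall n : nat, (N <= n)%nat -> Cnorm (lam n) / INR n <= beta + eps) ->
  forall (gamma x0 : R), 0 < gamma ->
  forall (f : R -> Cplx) (D : nat -> R -> Cplx),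
    (* D k = D^{(k)} f on [x0, x0+gamma]: D^{(0)} f = f and
       D^{(k+1)} f = (d/dt - lam k) D^{(k)} f, one-sided derivatives at the endpoints;
       the existence of all these derivatives expresses f in C^oo[x0, x0+gamma] *)
    (forall t, x0 <= t <= x0 + gamma -> D O t = f t) ->
    (forall k : nat,
        Chas_deriv_on (D k) (fun t => Cadd (D (S k) t) (Cmul (lam k) (D k t)))
          x0 (x0 + gamma)) ->
  forall (sigma Cst : R), 0 <= sigma -> 0 < Cst ->
    (forall (n : nat) (t : R), x0 <= t <= x0 + gamma ->
        Cnorm (D (2 * n)%nat t) <= Cst * INR (fact (2 * n)) * sigma ^ (2 * n)) ->
  exists delta, 0 < delta < gamma /\
    forall eps, 0 < eps -> exists N : nat,
      forall (n : nat) (x : R), (N <= n)%nat -> x0 <= x <= x0 + delta ->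
        Cnorm (Csub
          (Csum (fun k => Cmul (D k x0) (Phi lam k (RtoC (x - x0)))) (2 * n))
          (f x)) < eps.
Proof.
  intros lam beta Hbeta Hlim gamma x0 Hgamma f D Hf HD sigma Cst Hsigma HCst Hbound.
  (* Any fixed slack above [beta] would do; 1 gives the slope [beta + 1]. *)
  destruct (Hlim 1 Rlt_0_1) as [N0 HN0].
  assert (Hbeta1 : 0 <= beta + 1) by lra.
  destruct (lam_linear_growth lam (beta + 1) N0 Hbeta1) as [M0 [HM0 HM]].
  { intros n Hn. rewrite <- Cnorm_Cmod. apply HN0, Hn. }
  set (e := exp (beta + 1)).
  assert (He : 0 < e) by apply exp_pos.
  (* The bound 1 on [delta] gives [exp (M * delta) <= exp M]; the second bound gives
     [sigma * delta * e <= / 2], with [sigma + 1] in place of [sigma] to allow [sigma = 0]. Below,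
     [gamma / 2] makes [delta < gamma] strict. *)
  set (d := Rmin 1 (/ (2 * (sigma + 1) * e))).
  assert (Hden : 0 < 2 * (sigma + 1) * e) by (apply Rmult_lt_0_compat; lra).
  set (delta := Rmin (gamma / 2) d).
  assert (Hdelta : 0 < delta)
    by (repeat apply Rmin_glb_lt; [lra | lra | apply Rinv_0_lt_compat, Hden]).
  assert (Hdg : delta <= gamma / 2) by apply Rmin_l.
  assert (Hd1 : delta <= 1) by (eapply Rle_trans; [apply Rmin_r | apply Rmin_l]).
  assert (Hds : sigma * delta * e <= / 2).
  { assert (Hd2 : delta <= / (2 * (sigma + 1) * e))
      by (eapply Rle_trans; [apply Rmin_r | apply Rmin_r]).
    apply Rmult_le_compat_r with (r := (sigma + 1) * e) in Hd2; [|nra].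
    replace (/ (2 * (sigma + 1) * e) * ((sigma + 1) * e)) with (/ 2) in Hd2 by (field; lra).
    assert (0 < delta * e) by (apply Rmult_lt_0_compat; assumption). nra. }
  exists delta. split; [lra|].
  intros eps Heps.
  set (A := Cst * exp M0).
  assert (HA : 0 < A) by (apply Rmult_lt_0_compat; [exact HCst | apply exp_pos]).
  destruct (pow_lt_1_zero (/ 2) ltac:(rewrite Rabs_pos_eq; lra) (eps / (2 * A))) as [N1 HN1].
  { apply Rdiv_lt_0_compat; lra. }
  (* The successor ensures [n >= 1], so that [2 * n = S k] and the remainder bound applies with last
     index [k]. *)
  exists (S N1). intros n x Hn Hx.
  rewrite Cnorm_Cmod.
  destruct n as [|n']; [lia|]. set (n := S n') in *.
  set (k := pred (2 * n)).
  assert (Ek : (2 * n)%nat = S k) by (unfold k, n; lia).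
  set (M := M0 + (beta + 1) * INR (2 * n)).
  assert (HM0' : 0 <= M) by (unfold M; generalize (pos_INR (2 * n)); nra).
  assert (HR := Taylor_remainder_bound lam D x0 x M
    (Cst * INR (fact (2 * n)) * sigma ^ (2 * n)) k ltac:(lra)).
  rewrite <- Ek, (Hf x) in HR by lra.
  change (Csub ?a ?b) with (Cminus a b).
  eapply Rle_lt_trans; [apply HR|].
  - intros j. apply (Chas_deriv_on_subinterval _ _ _ _ _ _ (HD j)); lra.
  - intros j Hj. apply HM; lia.
  - intros t Ht. rewrite <- Cnorm_Cmod. apply Hbound; lra.
  (* With [q = sigma * delta * e <= / 2], the remainder is at most [A * 2n * q^(2n)], hence at most
     [2 * A * (/ 2) ^ n], which is below [eps] by the choice of [N1]. *)
  - apply Rle_lt_trans with (A * (2 * (/ 2) ^ n)).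
    2:{ specialize (HN1 n ltac:(lia)).
        rewrite Rabs_pos_eq in HN1 by (apply pow_le; lra).
        apply Rmult_lt_compat_l with (r := 2 * A) in HN1; [|lra].
        replace (2 * A * (eps / (2 * A))) with eps in HN1 by (field; lra). lra. }
    apply Rle_trans with (A * (INR (2 * n) * (/ 2) ^ (2 * n))).
    2:{ apply Rmult_le_compat_l; [lra | apply INR_mult_half_pow_le]. }
    apply Rle_trans with (Cst * INR (fact (2 * n)) * sigma ^ (2 * n) *
      ((exp M0 * e ^ (2 * n)) * (delta ^ k / INR (fact k))) * delta).
    + assert (HB : 0 <= Cst * INR (fact (2 * n)) * sigma ^ (2 * n)).
      { apply Rmult_le_pos; [|apply pow_le, Hsigma].
        apply Rmult_le_pos; [lra | apply pos_INR]. }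
      assert (Hx0 : 0 <= (x - x0) ^ k) by (apply pow_le; lra).
      assert (Hf0 : 0 < / INR (fact k)) by apply Rinv_0_lt_compat, INR_fact_lt_0.
      apply Rmult_le_compat; [| lra | | lra].
      { apply Rmult_le_pos; [exact HB|]. apply Rmult_le_pos; [apply Rlt_le, exp_pos|].
        apply Rmult_le_pos; lra. }
      apply Rmult_le_compat_l; [exact HB|].
      apply Rmult_le_compat.
      * apply Rlt_le, exp_pos.
      * apply Rmult_le_pos; lra.
      (* Both sides become exponentials, and [x - x0 <= 1] compares the exponents. *)
      * unfold e. rewrite <- Rpower_pow by apply exp_pos. unfold Rpower. rewrite ln_exp.
        rewrite <- exp_plus.
        assert (Hle : M * (x - x0) <= M0 + INR (2 * n) * (beta + 1)).
        { replace (M0 + INR (2 * n) * (beta + 1)) with (M * 1) by (unfold M; ring).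
          apply Rmult_le_compat_l; lra. }
        destruct Hle as [Hlt|Heq]; [apply Rlt_le, exp_increasing, Hlt | rewrite Heq; lra].
      * apply Rmult_le_compat_r; [lra|]. apply pow_incr; lra.
    (* As [2 * n = S k], the factorials leave [INR (2 * n)], and the extra factor [delta] completes
       [delta ^ k] to [delta ^ (2 * n)]. *)
    + replace (Cst * INR (fact (2 * n)) * sigma ^ (2 * n) *
        ((exp M0 * e ^ (2 * n)) * (delta ^ k / INR (fact k))) * delta)
        with (A * (INR (2 * n) * (sigma * delta * e) ^ (2 * n))).
      * apply Rmult_le_compat_l; [lra|]. apply Rmult_le_compat_l; [apply pos_INR|].
        apply pow_incr. split; [|exact Hds].
        apply Rmult_le_pos; [|lra]. apply Rmult_le_pos; lra.
      * rewrite !Rpow_mult_distr. unfold A. rewrite Ek, fact_simpl, mult_INR.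
        simpl pow. field. apply INR_fact_neq_0.
Qed.
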